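(* Let $X=\{x\in\mathbb{R}^n\mid G(x)\le 0\}$ for a continuously differentiable function $G\colon\mathbb{R}^n\to\mathbb{R}^q$. Let $(\bar x,\bar y,\bar z,\bar u)\in\mathbb{R}^n\times\mathbb{R}^m\times\mathbb{R}^m\times\mathbb{R}^p$ be a feasible point of the Wolfe dual reformulation (WD), i.e., a point satisfying the constraint system $$G(x)\le 0,\quad g(x,y)\le 0,\quad -u\le 0,\quad f(x,y)-L(x,z,u)\le 0,\quad \nabla_2L(x,z,u)=0.$$ Then MFCQ for this constraint system is violated at $(\bar x,\bar y,\bar z,\bar u)$.
   Context: Let $f\colon\mathbb{R}^n\times\mathbb{R}^m\to\mathbb{R}$ and $g\colon\mathbb{R}^n\times\mathbb{R}^m\to\mathbb{R}^p$ be twice continuously differentiable such that, for each $x\in X$, $f(x,\cdot),g_1(x,\cdot),\ldots,g_p(x,\cdot)$ are convex. Vector inequalities are componentwise. $L(x,y,u):=f(x,y)+u^\top g(x,y)$, and $\nabla_2L$ denotes the gradient of $L$ with respect to its second argument. (WD): $\min_{x,y,z,u}\{F(x,y)\mid x\in X,\ g(x,y)\le 0,\ u\ge 0,\ f(x,y)\le L(x,z,u),\ \nabla_2L(x,z,u)=0\}$, with a continuously differentiable objective $F\colon\mathbb{R}^n\times\mathbb{R}^m\to\mathbb{R}$ (which plays no role for the constraint qualification). MFCQ: for a system $q_i(w)\le 0$ ($i=1,\ldots,\nu$), $q_i(w)=0$ ($i=\nu+1,\ldots,t$) with continuously differentiable $q_i\colon\mathbb{R}^s\to\mathbb{R}$,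 MFCQ holds at a feasible point $\bar w$ if the conditions $\sum_{i=1}^t v_i\nabla q_i(\bar w)=0$ and $v_i\ge 0$, $v_i\,q_i(\bar w)=0$ for $i=1,\ldots,\nu$ possess only the trivial solution $v_1=\dots=v_t=0$; it is violated at $\bar w$ otherwise. *)

(* Defs.v *)
From mathcomp Require Export all_boot all_order all_algebra.
From mathcomp Require Export all_classical all_reals all_analysis.

Set Implicit Arguments.
Unset Strict Implicit.
Unset Printing Implicit Defensive.

Export Order.TTheory GRing.Theory Num.Theory.
Export numFieldNormedType.Exports.

#[global] Open Scope classical_set_scope.
#[global] Open Scope ring_scope.

Definition vle {R : realType} {k : nat} (a b : 'rV[R]_k) : Prop :=
  forall i, a 0 i <= b 0 i.

Definition gradient {R : realType} {s : nat} (h : 'rV[R]_s -> R)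
    (w : 'rV[R]_s) : 'rV[R]_s :=
  \row_j 'D_(delta_mx 0 j) h w.

Definition C1 {R : realType} {s : nat} (h : 'rV[R]_s -> R) : Prop :=
  (forall w, differentiable h w) /\ continuous (gradient h).

Definition C2 {R : realType} {s : nat} (h : 'rV[R]_s -> R) : Prop :=
  C1 h /\ forall j, C1 (fun w => gradient h w 0 j).

(* A function on R^n x R^m seen as a function on R^(n + m). *)
Definition joint {R : realType} {n m : nat} {T : Type}
    (f : 'rV[R]_n -> 'rV[R]_m -> T) : 'rV[R]_(n + m) -> T :=
  fun w => f (lsubmx w) (rsubmx w).

Section ConstraintSystem.
(* The system  c w <= 0 (nu inequalities),  d w = 0 (eta equations). *)
Context {R : realType} {s nu eta : nat}.
Variables (c : 'rV[R]_s -> 'rV[R]_nu) (d : 'rV[R]_s -> 'rV[R]_eta).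

Definition feasible (w : 'rV[R]_s) : Prop := vle (c w) 0 /\ d w = 0.

(* Dual (positive linear independence) form; only meaningful when c and d are
   continuously differentiable and w is feasible. *)
Definition MFCQ (w : 'rV[R]_s) : Prop :=
  forall (v : 'rV[R]_nu) (e : 'rV[R]_eta),
    \sum_i v 0 i *: gradient (fun w' => c w' 0 i) w
      + \sum_j e 0 j *: gradient (fun w' => d w' 0 j) w = 0 ->
    (forall i, 0 <= v 0 i /\ v 0 i * c w 0 i = 0) ->
    v = 0 /\ e = 0.

End ConstraintSystem.

Definition lagrangian {R : realType} {n m p : nat}
    (f : 'rV[R]_n -> 'rV[R]_m -> R) (g : 'rV[R]_n -> 'rV[R]_m -> 'rV[R]_p)
    (x : 'rV[R]_n) (y : 'rV[R]_m) (u : 'rV[R]_p) : R :=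
  f x y + \sum_i u 0 i * g x y 0 i.

Section WolfeDual.
Context {R : realType} {n m p q : nat}.
Variables (G : 'rV[R]_n -> 'rV[R]_q) (f : 'rV[R]_n -> 'rV[R]_m -> R)
  (g : 'rV[R]_n -> 'rV[R]_m -> 'rV[R]_p).

(* The variables (x, y, z, u) of (WD), stacked into one vector. *)
Definition wd_point (x : 'rV[R]_n) (y z : 'rV[R]_m) (u : 'rV[R]_p) :
    'rV[R]_(n + m + m + p) :=
  row_mx (row_mx (row_mx x y) z) u.

Definition wd_x (w : 'rV[R]_(n + m + m + p)) : 'rV[R]_n :=
  lsubmx (lsubmx (lsubmx w)).
Definition wd_y (w : 'rV[R]_(n + m + m + p)) : 'rV[R]_m :=
  rsubmx (lsubmx (lsubmx w)).
Definition wd_z (w : 'rV[R]_(n + m + m + p)) : 'rV[R]_m := rsubmx (lsubmx w).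
Definition wd_u (w : 'rV[R]_(n + m + m + p)) : 'rV[R]_p := rsubmx w.

Definition wd_ineq (w : 'rV[R]_(n + m + m + p)) : 'rV[R]_(q + p + p + 1) :=
  let: (x, y, z, u) := (wd_x w, wd_y w, wd_z w, wd_u w) in
  row_mx (row_mx (row_mx (G x) (g x y)) (- u))
    (const_mx (f x y - lagrangian f g x z u)).

Definition wd_eq (w : 'rV[R]_(n + m + m + p)) : 'rV[R]_m :=
  let: (x, z, u) := (wd_x w, wd_z w, wd_u w) in
  gradient (fun y' => lagrangian f g x y' u) z.

End WolfeDual.

(* Main.v *)
Require Import Defs.
From mathcomp Require Import ring lra.

(** Weak duality makes the constraints of the Wolfe dual reformulation
    degenerate.  Write L for the Lagrangian and put
    [gap (x, y, z, u) = f x y - L x z u + <z - y, grad_2 L x z u>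
                        + <u, g x y>]
    (the function [wolfe_gap] below), a combination of the constraint functions
    whose coefficients are themselves functions of the point.  As
    [f x y + <u, g x y> = L x y u], it is also the remainder
    [L x y u - L x z u - <y - z, grad_2 L x z u>] of the first-order expansion
    of [L x _ u] at z, so that by convexity it is nonnegative at every point
    with [G x <= 0] and [0 <= u] ([wolfe_gap_ge0]).  At a feasible point of the
    whole system its three terms are nonpositive, zero and nonpositive; hence
    all of them vanish, and the feasible point minimizes the gap over
    [G x <= 0], [0 <= u].

    The Fritz John conditions ([fritz_john]) for this minimum give nonnegative
    multipliers (l, a, b), not all zero, with
    [l * grad gap + a * grad G - b * grad u = 0].  By the product rule
    ([gradient_wolfe_gap]) the gradient of the gap is itself a combination of
    the gradients of the constraints of the full system, because the term
    [<grad (z - y), grad_2 L>] vanishes at a feasible point and [g * grad u] is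
    a combination of the gradients of the constraints [- u <= 0].  Substituting
    gives multipliers for the full system: a for G, [l * u] for g, [b - l * g]
    for [- u], l for the optimal value constraint and [l * (z - y)] for the
    stationarity equation.  They have the right signs and satisfy
    complementarity, since each [u_i * g_i] and the optimal value constraint
    are zero at the point, and they vanish only if (l, a, b) does.

    The Fritz John conditions are derived from Gordan's theorem of the
    alternative, which in turn comes from the point of least Euclidean norm in
    the convex hull of finitely many vectors. *)

(** * Differentiability of functions of row vectors *)

Lemma differentiable_sumf {R : realType} {V : normedModType R} {k}
    (h : 'I_k -> V -> R) (w : V) :
  (forall i, differentiable (h i) w) ->
  differentiable (fun w' => \sum_i h i w') w.
Proof.
move=> hd; rewrite (_ : (fun _ => _) = \sum_i h i).
  exact: differentiable_sum.
by apply/funext => w'; rewrite fct_sumE.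
Qed.

Lemma differentiable_rV {R : realType} {V : normedModType R} {s}
    (a : V -> 'rV[R]_s) (w : V) :
  (forall j, differentiable (fun w' => a w' 0 j) w) -> differentiable a w.
Proof.
move=> ad.
rewrite (_ : a = \sum_j (fun w' => a w' 0 j *: delta_mx 0 j)).
  by apply: differentiable_sum => j; exact: differentiableZl.
by apply/funext => w'; rewrite fct_sumE -row_sum_delta.
Qed.

Lemma differentiable_entry {R : realType} {V : normedModType R} {s}
    (a : V -> 'rV[R]_s) (w : V) j :
  differentiable a w -> differentiable (fun w' => a w' 0 j) w.
Proof.
move=> ad; apply: (@differentiable_comp _ _ _ _ a (fun v => v 0 j)) => //.
exact: differentiable_coord.
Qed.

Lemma differentiable_row_mx {R : realType} {V : normedModType R} {n m}
    (a : V -> 'rV[R]_n) (b : V -> 'rV[R]_m) (w : V) :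
  differentiable a w -> differentiable b w ->
  differentiable (fun w' => row_mx (a w') (b w')) w.
Proof.
move=> ad bd; apply: differentiable_rV => j; case: (split_ordP j) => i ->.
  by under eq_fun do rewrite row_mxEl; exact: differentiable_entry.
by under eq_fun do rewrite row_mxEr; exact: differentiable_entry.
Qed.

(** * Calculus of gradients *)

Lemma gradient_ext {R : realType} {s} (h k : 'rV[R]_s -> R) (w : 'rV[R]_s) :
  h =1 k -> gradient h w = gradient k w.
Proof. by move=> /funext ->. Qed.

Lemma derive_gradient {R : realType} {s} (h : 'rV[R]_s -> R) (w d : 'rV[R]_s) :
  differentiable h w -> 'D_d h w = \sum_j d 0 j * gradient h w 0 j.
Proof.
move=> hd; rewrite deriveE// {1}[d]row_sum_delta linear_sum.
by apply: eq_bigr => j _; rewrite linearZ/= mxE deriveE.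
Qed.

Lemma gradientD {R : realType} {s} (h k : 'rV[R]_s -> R) (w : 'rV[R]_s) :
  differentiable h w -> differentiable k w ->
  gradient (fun w' => h w' + k w') w = gradient h w + gradient k w.
Proof.
by move=> hd kd; apply/rowP => j; rewrite !mxE deriveD//; exact: diff_derivable.
Qed.

Lemma gradientN {R : realType} {s} (h : 'rV[R]_s -> R) (w : 'rV[R]_s) :
  differentiable h w -> gradient (fun w' => - h w') w = - gradient h w.
Proof.
by move=> hd; apply/rowP => j; rewrite !mxE deriveN//; exact: diff_derivable.
Qed.

Lemma gradientM {R : realType} {s} (h k : 'rV[R]_s -> R) (w : 'rV[R]_s) :
  differentiable h w -> differentiable k w ->
  gradient (fun w' => h w' * k w') w =
    h w *: gradient k w + k w *: gradient h w.
Proof.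
by move=> hd kd; apply/rowP => j; rewrite !mxE deriveM//; exact: diff_derivable.
Qed.

Lemma gradient_sum {R : realType} {s k} (h : 'I_k -> 'rV[R]_s -> R)
    (w : 'rV[R]_s) :
  (forall i, differentiable (h i) w) ->
  gradient (fun w' => \sum_i h i w') w = \sum_i gradient (h i) w.
Proof.
move=> hd; apply/rowP => j; rewrite mxE.
rewrite (_ : (fun _ => _) = \sum_i h i); last first.
  by apply/funext => w'; rewrite fct_sumE.
rewrite derive_sum => [|i]; last exact: diff_derivable.
by rewrite summxE; apply: eq_bigr => i _; rewrite mxE.
Qed.

(** * Gordan's theorem of the alternative *)

(** Over the convex hull of the rows of A the Euclidean norm has a minimizer x.
    If x = 0 the first alternative holds.  Otherwise moving from x towards a
    row a cannot decrease the norm, which forces [<x, x> <= <x, a>], so that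
    [- x] is a direction as in the second alternative. *)
Lemma gordan {R : realType} {k s} (A : 'M[R]_(k.+1, s)) :
  (exists v : 'rV[R]_k.+1, [/\ forall i, 0 <= v 0 i, v != 0 & v *m A = 0]) \/
  (exists d : 'rV[R]_s, forall i, (d *m A^T) 0 i < 0).
Proof.
pose dot (x y : 'rV[R]_s) := \sum_j x 0 j * y 0 j.
have dotC x y : dot x y = dot y x by apply: eq_bigr => j _; rewrite mulrC.
have dotD x y z : dot (x + y) z = dot x z + dot y z.
  by rewrite -big_split; apply: eq_bigr => j _; rewrite !mxE mulrDl.
have dotZ a x z : dot (a *: x) z = a * dot x z.
  by rewrite mulr_sumr; apply: eq_bigr => j _; rewrite !mxE mulrA.
have dotN x z : dot (- x) z = - dot x z by rewrite -scaleN1r dotZ mulN1r.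
have dotDr x y z : dot z (x + y) = dot z x + dot z y.
  by rewrite dotC dotD !(dotC z).
have dotZr a x z : dot z (a *: x) = a * dot z x by rewrite dotC dotZ (dotC z).
have dotNr x z : dot z (- x) = - dot z x by rewrite dotC dotN (dotC z).
have dot0 x : dot x x = 0 -> x = 0.
  move=> /psumr_eq0P dx; apply/rowP => j; rewrite mxE.
  apply/eqP; rewrite -[_ == _]orbb -mulf_eq0 dx// => i _.
  by rewrite -expr2 sqr_ge0.
pose K : set 'rV[R]_k.+1 :=
  [set v | (forall i, 0 <= v 0 i) /\ \sum_i v 0 i = 1].
have sumc : continuous (fun v : 'rV[R]_k.+1 => \sum_i v 0 i).
  move=> v; apply/differentiable_continuous/differentiable_sumf => i.
  exact: differentiable_coord.
have Nc : continuous (fun v : 'rV[R]_k.+1 => dot (v *m A) (v *m A)).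
  move=> v; apply/differentiable_continuous/differentiable_sumf => j.
  suff d : differentiable (fun v' : 'rV[R]_k.+1 => (v' *m A) 0 j) v.
    exact: differentiableM.
  under eq_fun do rewrite mxE.
  apply: differentiable_sumf => i.
  by apply: differentiableM;
    [exact: differentiable_coord|exact: differentiable_cst].
have K0 : K !=set0.
  exists (delta_mx 0 0); split=> [i|]; first by rewrite mxE; case: (_ && _).
  rewrite (bigD1 0)//= big1 ?mxE ?eqxx ?addr0// => i /negPf i0.
  by rewrite mxE i0 andbF.
have Kcl : closed K.
  rewrite (_ : K =
      \bigcap_(i in [set: 'I_k.+1]) ((fun v => v 0 i) @^-1` [set x | 0 <= x])
      `&` ((fun v => \sum_i v 0 i) @^-1` [set x | x = 1])); last first.
    by apply/seteqP; split=> v /= [v0 v1]; split=> // i; [move=> _|]; exact: v0.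
  apply: closedI; last first.
    by apply: (preimage_closed _ (@closed_eq _ _)) => v _; exact: sumc.
  apply: closed_bigI => i _; apply: (preimage_closed _ (@closed_ge _ _)) => v _.
  exact: coord_continuous.
have Kb : compact K.
  apply: (@subclosed_compact _ _
    [set v : 'rV[R]_k.+1 | forall i, v ord0 i \in `[0, 1]]) => //.
    apply: (@rV_compact R _ (fun=> `[0, 1]%classic)).
    by move=> _; exact: segment_compact.
  move=> v [v0 v1] i /=; rewrite in_itv/= v0 -v1 (bigD1 i)//= lerDl.
  by apply: sumr_ge0 => j _; exact: v0.
have [v /set_mem [v0 v1] vmin] := EVT_min_rV K0 Kb (continuous_subspaceT Nc).
have vn0 : v != 0.
  apply/eqP => ve; move: v1; rewrite ve big1 => [/eqP|i _]; last by rewrite mxE.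
  by rewrite eq_sym oner_eq0.
have [vA|vA] := eqVneq (v *m A) 0; [by left; exists v|right].
set x := v *m A in vA vmin.
exists (- x) => i; rewrite mulNmx mxE oppr_lt0.
pose a := row i A.
have -> : (x *m A^T) 0 i = dot x a.
  by rewrite mxE; apply: eq_bigr => j _; rewrite !mxE.
have xx : 0 < dot x x.
  rewrite lt_neqAle sumr_ge0 ?andbT => [|j _]; last by rewrite -expr2 sqr_ge0.
  by apply/eqP => /esym/dot0/eqP; rewrite (negPf vA).
rewrite (lt_le_trans xx)// leNgt; apply/negP => xa.
have step (t : R) : 0 <= t <= 1 ->
    dot x x <= dot (x + t *: (a - x)) (x + t *: (a - x)).
  move=> /andP[t0 t1].
  have -> : x + t *: (a - x) = ((1 - t) *: v + t *: delta_mx 0 i) *m A.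
    rewrite mulmxDl -!scalemxAl -rowE -/a -/x scalerBl scalerBr scale1r.
    by rewrite -addrA [- _ + _]addrC.
  apply: vmin; apply/mem_set; split=> [j|].
    by rewrite !mxE addr_ge0// mulr_ge0// ?subr_ge0//; case: (_ && _).
  rewrite (eq_bigr (fun j => (1 - t) * v 0 j + t * (j == i)%:R)) => [|j _].
    rewrite big_split/= -mulr_sumr v1 (bigD1 i)//= big1 ?eqxx => [|j /negPf->].
      by rewrite !mulr1 addr0 subrK.
    by rewrite mulr0.
  by rewrite !mxE.
have dxx t : dot (x + t *: (a - x)) (x + t *: (a - x)) =
    dot x x - t * (2 * (dot x x - dot x a) - t * dot (a - x) (a - x)).
  rewrite !(dotD, dotZ, dotN, dotDr, dotZr, dotNr) (dotC a x).
  by ring.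
(* The bracket in [dxx] equals [2 * e - t * b]; the step [t = e / (e + b)] lies
   in [0, 1] and satisfies [t * b <= e], which keeps the bracket positive. *)
set e := dot x x - dot x a in dxx.
set b := dot (a - x) (a - x) in dxx.
have e0 : 0 < e by rewrite subr_gt0.
have b0 : 0 <= b by apply: sumr_ge0 => j _; rewrite -expr2 sqr_ge0.
have eb0 : 0 < e + b by rewrite ltr_wpDr.
have t0 : 0 < e / (e + b) by rewrite divr_gt0.
have t1 : e / (e + b) <= 1 by rewrite ler_pdivrMr// mul1r lerDl.
have := step (e / (e + b)); rewrite t1 ltW// => /(_ isT).
rewrite dxx lerDl oppr_ge0 leNgt => /negP; apply; rewrite mulr_gt0//.
have : e / (e + b) * b <= e.
  by rewrite mulrAC ler_pdivrMr// ler_pM2l// lerDr ltW.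
lra.
Qed.

(** * Fritz John necessary conditions *)

Lemma descent {R : realType} {s} (h : 'rV[R]_s -> R) (w d : 'rV[R]_s) :
  differentiable h w -> 'D_d h w < 0 ->
  \forall t \near 0^'+, h (t *: d + w) < h w.
Proof.
move=> hd hlt.
have /cvg_dnbhs_at_right qcvg := diff_derivable (v := d) hd.
near=> t.
have t0 : 0 < t by near: t; exact: nbhs_right_gt.
have : t^-1 *: (h (t *: d + w) - h w) < 0.
  by near: t; exact: (cvgr_lt _ qcvg).
by rewrite pmulr_rlt0 ?invr_gt0// subr_lt0.
Unshelve. all: by end_near. Qed.

(** The case distinction between active and inactive constraints is absorbed
    by Gordan's theorem applied to the rows [(grad h, 0)] and
    [(grad c_i, c_i w)].  A nonnegative dependence of these rows has a last
    coordinate [sum v_i * c_i w = 0] with terms of one sign, which is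
    complementarity.  A direction (d1, d2) on which all rows are negative gives
    a strict descent direction d1 for h and for every active constraint, and
    such a direction contradicts minimality. *)
Lemma fritz_john {R : realType} {s k} (h : 'rV[R]_s -> R)
    (c : 'rV[R]_s -> 'rV[R]_k) (w : 'rV[R]_s) :
  differentiable h w -> (forall i, differentiable (fun w' => c w' 0 i) w) ->
  vle (c w) 0 -> (forall w', vle (c w') 0 -> h w <= h w') ->
  exists (l : R) (v : 'rV[R]_k),
    [/\ 0 <= l, forall i, 0 <= v 0 i /\ v 0 i * c w 0 i = 0,
        l != 0 \/ v != 0 &
        l *: gradient h w
          + \sum_i v 0 i *: gradient (fun w' => c w' 0 i) w = 0].
Proof.
move=> hd cd cw hmin.
have c0 i : c w 0 i <= 0 by move: (cw i); rewrite [leRHS]mxE.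
pose J := \matrix_i gradient (fun w' => c w' 0 i) w.
pose A : 'M[R]_(1 + k, s + 1) := block_mx (gradient h w) 0 J (c w)^T.
have [[lv [lv0 lvn0 lvA]]|[d dA]] := gordan A.
  have [l [v lvE]] : exists (l : 'rV[R]_1) (v : 'rV[R]_k), lv = row_mx l v.
    exists (lsubmx (lv : 'rV_(1 + k))), (rsubmx (lv : 'rV_(1 + k))).
    by rewrite hsubmxK.
  have : row_mx l v *m A = 0 by rewrite -lvE.
  rewrite mul_row_block mulmx0 add0r -row_mx0.
  move=> /eq_row_mx [gr cs].
  have l0 : 0 <= l 0 0.
    by rewrite -(row_mxEl l v) -lvE; exact: lv0.
  have v0 i : 0 <= v 0 i.
    by rewrite -(row_mxEr l v) -lvE; exact: lv0.
  exists (l 0 0), v; split=> //.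
  - move=> i; split=> //.
    have : \sum_j - (v 0 j * c w 0 j) = 0.
      have : (v *m (c w)^T) 0 0 = 0 by rewrite cs mxE.
      rewrite mxE sumrN => vc; rewrite -[RHS]oppr0 -[in RHS]vc; congr (- _).
      by apply: eq_bigr => j _; rewrite [in RHS]mxE.
    move=> /psumr_eq0P h0; apply/eqP; rewrite -oppr_eq0 h0// => j _.
    by rewrite oppr_ge0 mulr_ge0_le0//; have := cw j; rewrite [_ 0 j]mxE.
  - apply/orP; rewrite -negb_and.
    apply: contra lvn0 => /andP[/eqP l00 /eqP v00].
    have -> : lv = 0; last by [].
    by rewrite lvE v00 [l]mx11_scalar l00 -scalemx1 scale0r row_mx0.
  - rewrite -[X in _ = X]gr [in RHS](mx11_scalar l) mul_scalar_mx.
    congr (_ + _).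
    by rewrite mulmx_sum_row; apply: eq_bigr => i _; rewrite rowK.
exfalso.
have [d1 [d2 dE]] : exists (d1 : 'rV[R]_s) (d2 : R), d = row_mx d1 d2%:M.
  by exists (lsubmx d), (rsubmx d 0 0); rewrite -mx11_scalar hsubmxK.
have dAE : d *m A^T =
    row_mx (d1 *m (gradient h w)^T) (d1 *m J^T + d2 *: c w).
  rewrite dE tr_block_mx mul_row_block trmx0 mulmx0 addr0 trmxK.
  by rewrite mul_scalar_mx.
have hlt : 'D_d1 h w < 0.
  have : (d *m A^T) 0 (lshift k 0) < 0 by exact: dA.
  rewrite dAE row_mxEl mxE derive_gradient//.
  by under eq_bigr do rewrite [_^T _ _]mxE.
have clt i : 'D_d1 (fun w' => c w' 0 i) w + d2 * c w 0 i < 0.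
  have : (d *m A^T) 0 (rshift 1 i) < 0 by exact: dA.
  rewrite dAE row_mxEr mxE [X in X + _]mxE [X in _ + X]mxE derive_gradient//.
  by under eq_bigr do rewrite [_^T _ _]mxE [J _ _]mxE.
have cnear i : \forall t \near 0^'+, c (t *: d1 + w) 0 i <= 0.
  have := c0 i; rewrite le_eqVlt => /orP[/eqP ci0|ci0].
    move: (clt i); rewrite ci0 mulr0 addr0 => /(descent _ _ _ (cd i)).
    by apply: filterS => t; rewrite ci0 => /ltW.
  have cont : (fun t : R => c (t *: d1 + w) 0 i) @ 0^'+ --> c w 0 i.
    apply: cvg_at_right_filter.
    rewrite -[in X in _ --> X](add0r w) -(scale0r d1).
    apply: (@continuous_comp _ _ _ (fun t : R => t *: d1 + w)
              (fun w' => c w' 0 i)).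
      by apply: cvgD; [exact: scalel_continuous|exact: cvg_cst].
    rewrite scale0r add0r; exact/differentiable_continuous.
  by apply: filterS (cvgr_lt _ cont _ ci0) => t /ltW.
have call : \forall t \near 0^'+, forall i, c (t *: d1 + w) 0 i <= 0.
  by apply: filter_forall => i; exact: cnear.
have [t [tc th]] : exists t, vle (c (t *: d1 + w)) 0 /\ h (t *: d1 + w) < h w.
  near (0 : R)^'+ => t; exists t; split=> [i|].
    by rewrite mxE; move: i; near: t; exact: call.
  by near: t; exact: (descent _ _ _ hd hlt).
by have := hmin _ tc; rewrite leNgt th.
Unshelve. all: by end_near. Qed.

(** * Convexity and weak duality *)

(** The difference quotients of phi along the segment from z to y are bounded
    by [phi y - phi z], hence so is their limit. *)
Lemma convex_gradient_ineq {R : realType} {m} (phi : 'rV[R]_m -> R)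
    (y z : 'rV[R]_m) :
  convex_function (setT : set (convex_lmodType 'rV[R]_m)) phi ->
  derivable phi z (y - z) ->
  phi z + 'D_(y - z) phi z <= phi y.
Proof.
move=> cvx /cvg_dnbhs_at_right qcvg.
rewrite addrC -lerBrDr leNgt; apply/negP => Dgt.
near (0 : R)^'+ => t.
have t0 : 0 < t by near: t; exact: nbhs_right_gt.
have t1 : t <= 1 by near: t; exact: nbhs_right_le.
have : phi y - phi z < t^-1 *: (phi (t *: (y - z) + z) - phi z).
  by near: t; exact: (cvgr_gt _ qcvg).
apply/negP; rewrite -leNgt /GRing.scale/= mulrC ler_pdivrMr//.
have h : phi (t *: y + (1 - t) *: z) <= t * phi y + (1 - t) * phi z.
  exact: (cvx (Itv01 (ltW t0) t1) y z (mem_set I) (mem_set I)).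
rewrite lerBlDr.
have -> : t *: (y - z) + z = t *: y + (1 - t) *: z.
  by rewrite scalerBr scalerBl scale1r -addrA [- _ + z]addrC.
by rewrite (le_trans h)// le_eqVlt; apply/orP; left; apply/eqP; ring.
Unshelve. all: by end_near. Qed.

Lemma differentiable_joint {R : realType} {V : normedModType R} {n m}
    (f : 'rV[R]_n -> 'rV[R]_m -> R)
    (a : V -> 'rV[R]_n) (b : V -> 'rV[R]_m) (w : V) :
  differentiable (joint f) (row_mx (a w) (b w)) ->
  differentiable a w -> differentiable b w ->
  differentiable (fun w' => f (a w') (b w')) w.
Proof.
move=> fd ad bd.
rewrite (_ : (fun _ => _) = joint f \o (fun w' => row_mx (a w') (b w'))).
  by apply: differentiable_comp => //; exact: differentiable_row_mx.
by apply/funext => w'; rewrite /joint/= row_mxKl row_mxKr.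
Qed.

Lemma differentiable_slice {R : realType} {n m}
    (f : 'rV[R]_n -> 'rV[R]_m -> R) (x : 'rV[R]_n) (z : 'rV[R]_m) :
  differentiable (joint f) (row_mx x z) -> differentiable (f x) z.
Proof. by move=> fd; apply: (differentiable_joint f (cst x) id). Qed.

Lemma gradient_slice {R : realType} {n m} (f : 'rV[R]_n -> 'rV[R]_m -> R)
    (x : 'rV[R]_n) (z : 'rV[R]_m) j :
  gradient (f x) z 0 j = gradient (joint f) (row_mx x z) 0 (rshift n j).
Proof.
rewrite !mxE delta_mx_rshift /derive; set d := (fun _ : R => _).
set d' := (fun _ : R => _); suff -> : d = d' by [].
apply/funext => t; rewrite /d /d' /= /joint row_mxKl row_mxKr.
by rewrite scale_row_mx add_row_mx scaler0 add0r row_mxKl row_mxKr.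
Qed.

Lemma derive_lagrangian {R : realType} {n m p}
    (f : 'rV[R]_n -> 'rV[R]_m -> R) (g : 'rV[R]_n -> 'rV[R]_m -> 'rV[R]_p)
    (x : 'rV[R]_n) (z v : 'rV[R]_m) (u : 'rV[R]_p) :
  derivable (f x) z v ->
  (forall i, derivable (fun y => g x y 0 i) z v) ->
  'D_v (fun y => lagrangian f g x y u) z =
    'D_v (f x) z + \sum_i u 0 i * 'D_v (fun y => g x y 0 i) z.
Proof.
move=> fd gd.
rewrite (_ : (fun _ => _) = f x + \sum_i (u 0 i *: (fun y => g x y 0 i))).
  have ugd i : derivable (u 0 i *: (fun y => g x y 0 i)) z v.
    exact: derivableZ.
  rewrite deriveD//; last exact: derivable_sum.
  rewrite derive_sum//; congr (_ + _).
  by apply: eq_bigr => i _; rewrite deriveZ.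
by apply/funext => y; rewrite /lagrangian fctE fct_sumE.
Qed.

Definition value_gap {R : realType} {n m p} (f : 'rV[R]_n -> 'rV[R]_m -> R)
    (g : 'rV[R]_n -> 'rV[R]_m -> 'rV[R]_p) (w : 'rV[R]_(n + m + m + p)) : R :=
  f (wd_x w) (wd_y w) - lagrangian f g (wd_x w) (wd_z w) (wd_u w).

(** Written with the constraint functions of (WD), so that the product rule
    expresses its gradient through theirs; in closed form it is the Bregman
    distance from y to z of the convex function [L x _ u]. *)
Definition wolfe_gap {R : realType} {n m p} (f : 'rV[R]_n -> 'rV[R]_m -> R)
    (g : 'rV[R]_n -> 'rV[R]_m -> 'rV[R]_p) (w : 'rV[R]_(n + m + m + p)) : R :=
  value_gap f g w
  + \sum_j (wd_z w - wd_y w) 0 j * wd_eq f g w 0 j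
  + \sum_i wd_u w 0 i * g (wd_x w) (wd_y w) 0 i.

(** The Bregman distance of a convex function is nonnegative; convexity of L in
    y needs the multipliers u to be nonnegative. *)
Lemma wolfe_gap_ge0 {R : realType} {n m p} (f : 'rV[R]_n -> 'rV[R]_m -> R)
    (g : 'rV[R]_n -> 'rV[R]_m -> 'rV[R]_p) (w : 'rV[R]_(n + m + m + p)) :
  differentiable (f (wd_x w)) (wd_z w) ->
  (forall i, differentiable (fun y => g (wd_x w) y 0 i) (wd_z w)) ->
  convex_function (setT : set (convex_lmodType 'rV[R]_m)) (f (wd_x w)) ->
  (forall i, convex_function (setT : set (convex_lmodType 'rV[R]_m))
    (fun y => g (wd_x w) y 0 i)) ->
  (forall i, 0 <= wd_u w 0 i) ->
  0 <= wolfe_gap f g w.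
Proof.
rewrite /wolfe_gap /value_gap /wd_eq.
move: (wd_x w) (wd_y w) (wd_z w) (wd_u w) => x y z u fd gd fc gc u0.
have fD v : derivable (f x) z v by exact: diff_derivable.
have gD v i : derivable (fun y => g x y 0 i) z v by exact: diff_derivable.
have -> : \sum_j (z - y) 0 j * gradient (fun y' => lagrangian f g x y' u) z 0 j
    = - ('D_(y - z) (f x) z
         + \sum_i u 0 i * 'D_(y - z) (fun y => g x y 0 i) z).
  rewrite -derive_lagrangian// derive_gradient.
    rewrite -sumrN; apply: eq_bigr => j _.
    by rewrite -opprB [X in X * _]mxE mulNr.
  rewrite /lagrangian; apply: differentiableD => //.
  by apply: differentiable_sumf => i; apply: differentiableM.
have -> : f x y - lagrangian f g x z u
    - ('D_(y - z) (f x) z + \sum_i u 0 i * 'D_(y - z) (fun y => g x y 0 i) z)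
    + \sum_i u 0 i * g x y 0 i =
    (f x y - (f x z + 'D_(y - z) (f x) z)) +
    \sum_i u 0 i *
      (g x y 0 i - (g x z 0 i + 'D_(y - z) (fun y => g x y 0 i) z)).
  under [in RHS]eq_bigr do rewrite mulrBr mulrDr.
  by rewrite sumrB big_split/= /lagrangian; ring.
rewrite addr_ge0 ?subr_ge0 ?convex_gradient_ineq//.
apply: sumr_ge0 => i _; rewrite mulr_ge0// subr_ge0.
exact: (convex_gradient_ineq (fun y => g x y 0 i)).
Qed.

(** * First-order calculus of the constraints *)

Lemma differentiable_wd_x {R : realType} {n m p} (w : 'rV[R]_(n + m + m + p)) :
  differentiable wd_x w.
Proof.
rewrite (_ : wd_x = lsubmx \o (lsubmx \o lsubmx))//.
apply: differentiable_comp; last exact: differentiable_lsubmx.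
by apply: differentiable_comp; exact: differentiable_lsubmx.
Qed.

Lemma differentiable_wd_y {R : realType} {n m p} (w : 'rV[R]_(n + m + m + p)) :
  differentiable wd_y w.
Proof.
rewrite (_ : wd_y = rsubmx \o (lsubmx \o lsubmx))//.
apply: differentiable_comp; last exact: differentiable_rsubmx.
by apply: differentiable_comp; exact: differentiable_lsubmx.
Qed.

Lemma differentiable_wd_z {R : realType} {n m p} (w : 'rV[R]_(n + m + m + p)) :
  differentiable wd_z w.
Proof.
rewrite (_ : wd_z = rsubmx \o lsubmx)//.
by apply: differentiable_comp;
  [exact: differentiable_lsubmx|exact: differentiable_rsubmx].
Qed.

Lemma differentiable_wd_u {R : realType} {n m p} (w : 'rV[R]_(n + m + m + p)) :
  differentiable wd_u w.
Proof. exact: differentiable_rsubmx. Qed.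

Lemma differentiable_wd_u_entry {R : realType} {n m p} i
    (w : 'rV[R]_(n + m + m + p)) :
  differentiable (fun w' => wd_u w' 0 i) w.
Proof. by apply: differentiable_entry; exact: differentiable_wd_u. Qed.

Section WolfeGapCalculus.
Context {R : realType} {n m p : nat}.
Variables (f : 'rV[R]_n -> 'rV[R]_m -> R)
  (g : 'rV[R]_n -> 'rV[R]_m -> 'rV[R]_p).
Hypothesis f_C2 : C2 (joint f).
Hypothesis g_C2 : forall i, C2 (joint (fun x y => g x y 0 i)).
Implicit Type w : 'rV[R]_(n + m + m + p).

Lemma differentiable_wd_g i w :
  differentiable (fun w' => g (wd_x w') (wd_y w') 0 i) w.
Proof.
apply: (differentiable_joint (fun x y => g x y 0 i)).
- exact: (g_C2 i).1.1.
- exact: differentiable_wd_x.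
- exact: differentiable_wd_y.
Qed.

Lemma differentiable_value_gap w : differentiable (value_gap f g) w.
Proof.
apply: differentiableB.
  apply: (differentiable_joint f); first exact: f_C2.1.1.
  - exact: differentiable_wd_x.
  - exact: differentiable_wd_y.
apply: differentiableD.
  apply: (differentiable_joint f); first exact: f_C2.1.1.
  - exact: differentiable_wd_x.
  - exact: differentiable_wd_z.
apply: differentiable_sumf => i; apply: differentiableM.
  exact: differentiable_wd_u_entry.
apply: (differentiable_joint (fun x y => g x y 0 i)).
- exact: (g_C2 i).1.1.
- exact: differentiable_wd_x.
- exact: differentiable_wd_z.
Qed.

(** The stationarity equation involves only first derivatives of f and g in y,
    which are continuously differentiable because f and g are C2. *)
Lemma differentiable_wd_eq w j : differentiable (fun w' => wd_eq f g w' 0 j) w.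
Proof.
pose xz w' : 'rV[R]_(n + m) := row_mx (wd_x w') (wd_z w').
have xzd : differentiable xz w.
  by apply: differentiable_row_mx;
    [exact: differentiable_wd_x|exact: differentiable_wd_z].
rewrite (_ : (fun _ => _) = fun w' =>
    gradient (joint f) (xz w') 0 (rshift n j)
    + \sum_i wd_u w' 0 i *
        gradient (joint (fun x y => g x y 0 i)) (xz w') 0 (rshift n j)).
  apply: differentiableD.
    apply: (@differentiable_comp _ _ _ _ xz
      (fun v => gradient (joint f) v 0 (rshift n j))) => //.
    exact: (f_C2.2 _).1.
  apply: differentiable_sumf => i; apply: differentiableM.
    exact: differentiable_wd_u_entry.
  apply: (@differentiable_comp _ _ _ _ xz
      (fun v => gradient (joint (fun x y => g x y 0 i)) v 0 (rshift n j)))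
    => //.
  exact: ((g_C2 i).2 _).1.
apply/funext => w'; rewrite /wd_eq -gradient_slice.
under eq_bigr do rewrite -(gradient_slice (fun x y => g x y 0 _)).
rewrite mxE derive_lagrangian => [||i].
- by congr (_ + _); [|apply: eq_bigr => i _; congr (_ * _)]; rewrite mxE.
- apply: diff_derivable; apply: differentiable_slice; exact: f_C2.1.1.
- apply: diff_derivable; apply: (differentiable_slice (fun x y => g x y 0 i)).
  exact: (g_C2 i).1.1.
Qed.

Let differentiable_zy j w :
  differentiable (fun w' => (wd_z w' - wd_y w') 0 j) w.
Proof.
apply: differentiable_entry; apply: differentiableB.
  exact: differentiable_wd_z.
exact: differentiable_wd_y.
Qed.

Lemma differentiable_wolfe_gap w : differentiable (wolfe_gap f g) w.
Proof.
apply: differentiableD.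
  apply: differentiableD; first exact: differentiable_value_gap.
  apply: differentiable_sumf => j; apply: differentiableM.
    exact: differentiable_zy.
  exact: differentiable_wd_eq.
apply: differentiable_sumf => i; apply: differentiableM.
  exact: differentiable_wd_u_entry.
exact: differentiable_wd_g.
Qed.

(** The derivatives of the coefficients [z - y] do not contribute: they are
    multiplied by the value of the stationarity constraint, which is zero. *)
Lemma gradient_wolfe_gap w : wd_eq f g w = 0 ->
  gradient (wolfe_gap f g) w =
    gradient (value_gap f g) w
    + \sum_j (wd_z w - wd_y w) 0 j *: gradient (fun w' => wd_eq f g w' 0 j) w
    + \sum_i (wd_u w 0 i *: gradient (fun w' => g (wd_x w') (wd_y w') 0 i) w
        + g (wd_x w) (wd_y w) 0 i *: gradient (fun w' => wd_u w' 0 i) w).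
Proof.
move=> eq0.
have d1 j : differentiable
    (fun w' => (wd_z w' - wd_y w') 0 j * wd_eq f g w' 0 j) w.
  by apply: differentiableM;
    [exact: differentiable_zy|exact: differentiable_wd_eq].
have d2 i : differentiable
    (fun w' => wd_u w' 0 i * g (wd_x w') (wd_y w') 0 i) w.
  by apply: differentiableM;
    [exact: differentiable_wd_u_entry|exact: differentiable_wd_g].
have d3 := differentiable_value_gap w.
rewrite /wolfe_gap gradientD; last 2 first.
- by apply: differentiableD => //; exact: differentiable_sumf.
- exact: differentiable_sumf.
rewrite gradientD//; last exact: differentiable_sumf.
rewrite !gradient_sum//; congr (_ + _ + _); apply: eq_bigr => i _.
  rewrite gradientM; [|exact: differentiable_zy|exact: differentiable_wd_eq].
  by rewrite eq0 [(0 : 'rV_m) _ _]mxE scale0r addr0.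
by rewrite gradientM; [|exact: differentiable_wd_u_entry|
    exact: differentiable_wd_g].
Qed.

End WolfeGapCalculus.

Lemma sum_scale_row_mx {R : pzRingType} {V : lmodType R} {k l}
    (a : 'rV[R]_k) (b : 'rV[R]_l) (F : 'I_(k + l) -> V) :
  \sum_i row_mx a b 0 i *: F i =
    \sum_i a 0 i *: F (lshift l i) + \sum_i b 0 i *: F (rshift k i).
Proof.
by rewrite big_split_ord; congr (_ + _); apply: eq_bigr => i _;
  rewrite ?row_mxEl ?row_mxEr.
Qed.

(** * Multipliers for the full system *)

Section WolfeMultipliers.
Context {R : realType} {n m p q : nat}.
Variables (G : 'rV[R]_n -> 'rV[R]_q) (f : 'rV[R]_n -> 'rV[R]_m -> R)
  (g : 'rV[R]_n -> 'rV[R]_m -> 'rV[R]_p).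
Hypothesis f_C2 : C2 (joint f).
Hypothesis g_C2 : forall i, C2 (joint (fun x y => g x y 0 i)).
Implicit Type w : 'rV[R]_(n + m + m + p).

Lemma wd_ineq_G w i :
  wd_ineq G f g w 0 (lshift 1 (lshift p (lshift p i))) = G (wd_x w) 0 i.
Proof. by rewrite /wd_ineq !row_mxEl. Qed.

Lemma wd_ineq_g w i :
  wd_ineq G f g w 0 (lshift 1 (lshift p (rshift q i)))
  = g (wd_x w) (wd_y w) 0 i.
Proof. by rewrite /wd_ineq !row_mxEl row_mxEr. Qed.

Lemma wd_ineq_u w i :
  wd_ineq G f g w 0 (lshift 1 (rshift (q + p) i)) = - wd_u w 0 i.
Proof. by rewrite /wd_ineq row_mxEl row_mxEr mxE. Qed.

Lemma wd_ineq_gap w :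
  wd_ineq G f g w 0 (rshift (q + p + p) 0)
  = value_gap f g w.
Proof. by rewrite /wd_ineq row_mxEr mxE. Qed.

Lemma wd_ineq_combination (a : 'rV[R]_q) (r s : 'rV[R]_p) (t : R) w :
  \sum_i row_mx (row_mx (row_mx a r) s) (const_mx t) 0 i *:
      gradient (fun w' => wd_ineq G f g w' 0 i) w
  = \sum_i a 0 i *: gradient (fun w' => G (wd_x w') 0 i) w
    + \sum_i r 0 i *: gradient (fun w' => g (wd_x w') (wd_y w') 0 i) w
    + \sum_i s 0 i *: - gradient (fun w' => wd_u w' 0 i) w
    + t *: gradient (value_gap f g) w.
Proof.
rewrite !sum_scale_row_mx big_ord1 mxE.
rewrite (eq_bigr _ (fun i _ => congr1 ( *:%R (a 0 i))
  (gradient_ext _ _ w (fun w' => wd_ineq_G w' i)))).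
rewrite (eq_bigr _ (fun i _ => congr1 ( *:%R (r 0 i))
  (gradient_ext _ _ w (fun w' => wd_ineq_g w' i)))).
rewrite (eq_bigr _ (fun i _ => congr1 ( *:%R (s 0 i))
  (gradient_ext _ _ w (fun w' => wd_ineq_u w' i)))).
rewrite (gradient_ext _ _ w wd_ineq_gap).
by rewrite (eq_bigr _ (fun i _ => congr1 ( *:%R (s 0 i))
  (gradientN _ w (differentiable_wd_u_entry i w)))).
Qed.

(** The products [u_i * g_i] and the value gap are nonpositive, the stationarity
    equation removes the middle term of the gap, and the total is
    nonnegative. *)
Lemma wolfe_gap_tight w :
  feasible (wd_ineq G f g) (wd_eq f g) w -> 0 <= wolfe_gap f g w ->
  value_gap f g w = 0 /\
  forall i, wd_u w 0 i * g (wd_x w) (wd_y w) 0 i = 0.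
Proof.
move=> [ineq eq0].
have le0 i : wd_ineq G f g w 0 i <= 0 by move: (ineq i); rewrite [leRHS]mxE.
have h0 : value_gap f g w <= 0 by rewrite -wd_ineq_gap.
have ug_le0 i : wd_u w 0 i * g (wd_x w) (wd_y w) 0 i <= 0.
  by rewrite mulr_ge0_le0 -?wd_ineq_g// -oppr_le0 -wd_ineq_u.
have sum_ug : \sum_i wd_u w 0 i * g (wd_x w) (wd_y w) 0 i <= 0.
  exact: sumr_le0.
rewrite /wolfe_gap eq0 [X in _ + X + _]big1 ?addr0 => [gap0|j _]; last first.
  by rewrite [(0 : 'rV_m) _ _]mxE mulr0.
split=> [|i]; first by lra.
have : \sum_i - (wd_u w 0 i * g (wd_x w) (wd_y w) 0 i) = 0.
  by rewrite sumrN; lra.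
move=> /psumr_eq0P ug; apply/eqP; rewrite -oppr_eq0 ug// => j _.
by rewrite oppr_ge0.
Qed.

(** The gradient of the gap, expanded by the product rule, is redistributed over
    the constraints; [g_i * grad u_i] joins the multiplier of [- u_i <= 0],
    whence [b - l * g]. *)
Lemma wolfe_multipliers_combination (l : R) (a : 'rV[R]_q) (b : 'rV[R]_p) w :
  wd_eq f g w = 0 ->
  \sum_i row_mx (row_mx (row_mx a (l *: wd_u w))
        (b - l *: g (wd_x w) (wd_y w))) (const_mx l) 0 i *:
      gradient (fun w' => wd_ineq G f g w' 0 i) w
  + \sum_j (l *: (wd_z w - wd_y w)) 0 j *:
      gradient (fun w' => wd_eq f g w' 0 j) w
  = l *: gradient (wolfe_gap f g) w
    + (\sum_i a 0 i *: gradient (fun w' => G (wd_x w') 0 i) w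
       + \sum_i b 0 i *: - gradient (fun w' => wd_u w' 0 i) w).
Proof.
move=> eq0; rewrite (gradient_wolfe_gap f g f_C2 g_C2)// wd_ineq_combination.
pose gradg i := gradient
  (fun w' : 'rV[R]_(n + m + m + p) => g (wd_x w') (wd_y w') 0 i) w.
pose gradu i := gradient (fun w' : 'rV[R]_(n + m + m + p) => wd_u w' 0 i) w.
pose grade j := gradient (fun w' => wd_eq f g w' 0 j) w.
rewrite -/gradg -/gradu -/grade.
have -> : \sum_i (l *: wd_u w) 0 i *: gradg i
    = l *: \sum_i wd_u w 0 i *: gradg i.
  by rewrite scaler_sumr; apply: eq_bigr => i _; rewrite scalerA [in LHS]mxE.
have -> : \sum_i (b - l *: g (wd_x w) (wd_y w)) 0 i *: - gradu i
    = \sum_i b 0 i *: - gradu i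
      + l *: \sum_i g (wd_x w) (wd_y w) 0 i *: gradu i.
  rewrite scaler_sumr -big_split/=; apply: eq_bigr => i _.
  rewrite [(b - _) _ _]mxE [X in b 0 i + X]mxE [X in _ - X]mxE.
  by rewrite scalerBl [(_ * _) *: _]scalerN opprK scalerA.
have -> : \sum_j (l *: (wd_z w - wd_y w)) 0 j *: grade j
    = l *: \sum_j (wd_z w - wd_y w) 0 j *: grade j.
  by rewrite scaler_sumr; apply: eq_bigr => i _; rewrite scalerA [in LHS]mxE.
rewrite [in RHS]big_split/= !scalerDr.
have rearrange (A U B V H E : 'rV[R]_(n + m + m + p)) :
    A + U + (B + V) + H + E = H + E + (U + V) + (A + B).
  by apply/rowP => j; rewrite !mxE; ring.
exact: rearrange.
Qed.

End WolfeMultipliers.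

Theorem theorem4p14 (R : realType) (n m p q : nat)
    (f : 'rV[R]_n -> 'rV[R]_m -> R) (g : 'rV[R]_n -> 'rV[R]_m -> 'rV[R]_p)
    (G : 'rV[R]_n -> 'rV[R]_q) (X : set 'rV[R]_n)
    (f_C2 : C2 (joint f))
    (g_C2 : forall i, C2 (joint (fun x y => g x y 0 i)))
    (G_C1 : forall i, C1 (fun x => G x 0 i))
    (X_def : X = [set x | vle (G x) 0])
    (f_convex : forall x, X x ->
      convex_function (setT : set (convex_lmodType 'rV[R]_m)) (f x))
    (g_convex : forall x, X x -> forall i,
      convex_function (setT : set (convex_lmodType 'rV[R]_m))
        (fun y => g x y 0 i))
    (xb : 'rV[R]_n) (yb zb : 'rV[R]_m) (ub : 'rV[R]_p)
    (wd_feasible :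
      feasible (wd_ineq G f g) (wd_eq f g) (wd_point xb yb zb ub)) :
  ~ MFCQ (wd_ineq G f g) (wd_eq f g) (wd_point xb yb zb ub).
Proof.
move: (wd_point xb yb zb ub) wd_feasible => w [ineq eq0].
have le0 i : wd_ineq G f g w 0 i <= 0 by move: (ineq i); rewrite [leRHS]mxE.
have gap_ge0 w' : vle (G (wd_x w')) 0 -> (forall i, 0 <= wd_u w' 0 i) ->
    0 <= wolfe_gap f g w'.
  move=> Gx u0; have Xx : X (wd_x w') by rewrite X_def.
  apply: wolfe_gap_ge0 => //; [|move=> i| exact: f_convex|exact: g_convex].
    by apply: differentiable_slice; exact: f_C2.1.1.
  apply: (differentiable_slice (fun x y => g x y 0 i)); exact: (g_C2 i).1.1.
have Gw : vle (G (wd_x w)) 0.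
  by move=> i; rewrite [leRHS]mxE -(wd_ineq_G G f g).
have g0 i : g (wd_x w) (wd_y w) 0 i <= 0 by rewrite -(wd_ineq_g G f g).
have u0 i : 0 <= wd_u w 0 i by rewrite -oppr_le0 -(wd_ineq_u G f g).
have [h0 ug0] := wolfe_gap_tight G f g w (conj ineq eq0) (gap_ge0 w Gw u0).
have gapw0 : wolfe_gap f g w = 0.
  rewrite /wolfe_gap h0 eq0 !big1 ?addr0// => i _.
  by rewrite [(0 : 'rV_m) _ _]mxE mulr0.
(* The subsystem over which w minimizes the gap: [G x <= 0] and [- u <= 0]. *)
pose c (w' : 'rV[R]_(n + m + m + p)) : 'rV[R]_(q + p) :=
  row_mx (G (wd_x w')) (- wd_u w').
have cG i w' : c w' 0 (lshift p i) = G (wd_x w') 0 i by rewrite row_mxEl.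
have cu i w' : c w' 0 (rshift q i) = - wd_u w' 0 i.
  by rewrite row_mxEr [LHS]mxE.
have cd i : differentiable (fun w' => c w' 0 i) w.
  case: (split_ordP i) => j ->.
    under eq_fun do rewrite cG.
    apply: (@differentiable_comp _ _ _ _ wd_x (fun x => G x 0 j)).
      exact: differentiable_wd_x.
    exact: (G_C1 j).1.
  under eq_fun do rewrite cu.
  by apply: differentiableN; exact: differentiable_wd_u_entry.
have cle w' : vle (c w') 0 <->
    vle (G (wd_x w')) 0 /\ forall i, 0 <= wd_u w' 0 i.
  split=> [cw|[Gw' uw'] i].
    split=> i.
      by move: (cw (lshift p i)); rewrite cG !mxE.
    by move: (cw (rshift q i)); rewrite cu [leRHS]mxE oppr_le0.
  rewrite [leRHS]mxE; case: (split_ordP i) => j ->.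
    by rewrite cG; move: (Gw' j); rewrite [leRHS]mxE.
  by rewrite cu oppr_le0.
have [||l [v [l0 v0 lv0 stat]]] :=
    fritz_john _ c w (differentiable_wolfe_gap f g f_C2 g_C2 w) cd.
- by apply/cle.
- by move=> w' /cle[Gw' uw']; rewrite gapw0; exact: gap_ge0.
have [a [b vE]] : exists (a : 'rV[R]_q) (b : 'rV[R]_p), v = row_mx a b.
  by exists (lsubmx v), (rsubmx v); rewrite hsubmxK.
have a0 i : 0 <= a 0 i /\ a 0 i * G (wd_x w) 0 i = 0.
  by have := v0 (lshift p i); rewrite cG vE row_mxEl.
have b0 i : 0 <= b 0 i /\ b 0 i * - wd_u w 0 i = 0.
  by have := v0 (rshift q i); rewrite cu vE row_mxEr.
move=> mfcq; have [||ve0 _] := mfcq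
  (row_mx (row_mx (row_mx a (l *: wd_u w)) (b - l *: g (wd_x w) (wd_y w)))
     (const_mx l)) (l *: (wd_z w - wd_y w)).
- rewrite wolfe_multipliers_combination// -[RHS]stat vE; congr (_ + _).
  rewrite sum_scale_row_mx.
  rewrite (eq_bigr _ (fun i _ => congr1 ( *:%R (a 0 i))
    (gradient_ext _ _ w (cG i)))).
  rewrite (eq_bigr _ (fun i _ => congr1 ( *:%R (b 0 i))
    (gradient_ext _ _ w (cu i)))).
  by rewrite (eq_bigr _ (fun i _ => congr1 ( *:%R (b 0 i))
    (gradientN _ w (differentiable_wd_u_entry i w)))).
- move=> i; case: (split_ordP i) => {}i ->; rewrite ?row_mxEl ?row_mxEr.
    case: (split_ordP i) => {}i ->; rewrite ?row_mxEl ?row_mxEr.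
      case: (split_ordP i) => {}i ->; rewrite ?row_mxEl ?row_mxEr.
        exact: a0.
      by rewrite mxE mulr_ge0// -mulrA ug0 mulr0.
    have [bi0 bui] := b0 i.
    rewrite [(- wd_u w) _ _]mxE.
    rewrite (_ : _ 0 i = b 0 i - l * g (wd_x w) (wd_y w) 0 i); last first.
      by rewrite !mxE.
    split; first by rewrite addr_ge0// oppr_ge0 mulr_ge0_le0.
    rewrite mulrBl bui mulrN opprK -mulrA [_ * wd_u _ _ _]mulrC ug0.
    by rewrite mulr0 addr0.
  by rewrite ord1 !mxE -/(value_gap f g w) h0 mulr0.
(* The multiplier of the value constraint is l and that of G is a, so that both
   vanish; then [b - l * g] reduces to b. *)
move: ve0; rewrite -!row_mx0 => /eq_row_mx[/eq_row_mx[/eq_row_mx[aE _] bE] lE].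
have l00 : l = 0 by move/rowP: lE => /(_ 0); rewrite !mxE.
have b00 : b = 0 by rewrite -bE l00 scale0r subr0.
by case: lv0; rewrite ?l00 ?vE ?aE ?b00 ?row_mx0 eqxx.
Qed.
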